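(* Let $N\in\mathbb{N}$ and let $T=\sum_{g\in\mathrm{Supp}(T)}t_gu_g$ be a finitely supported element of the free group factor $L(F_N)$. Then $T$ is unitary if and only if both of the following hold: $$\{g_1^{-1}g_2: g_1,g_2\in\mathrm{Supp}(T)\}=\{e_{F_N}\}$$ and $$\sum_{(g_1,g_2)\in\mathrm{Supp}(T)^2}\overline{t_{g_1}}\,t_{g_2}=1 \quad\text{in } \mathbb{C},$$ where $e_{F_N}$ is the identity of $F_N$.
   Context: $F_N$ is the free group with $N$ generators, $\lambda$ is its left regular unitary representation on $l^2(F_N)$, $u_g=\lambda(g)$ for $g\in F_N$, and $L(F_N)$ is the group von Neumann algebra, i.e. the weak-operator closure of the linear span of $\{u_g:g\in F_N\}$ in $B(l^2(F_N))$. An element $T=\sum_{g\in F_N}t_gu_g$ ($t_g\in\mathbb{C}$) has support $\mathrm{Supp}(T)=\{g\in F_N:t_g\neq0\}$ and is finitely supported if this set is finite. *)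

(* Defs.v *)
From HB Require Import structures.
From mathcomp Require Import all_boot all_order all_algebra.
From mathcomp Require Import complex ring lra.
From mathcomp Require Import all_classical all_reals all_analysis.

Set Implicit Arguments.
Unset Strict Implicit.
Unset Printing Implicit Defensive.
Import Order.TTheory GRing.Theory Num.Theory.
Import numFieldNormedType.Exports.
Local Open Scope classical_set_scope.
Local Open Scope complex_scope.
Local Open Scope ring_scope.

(* The letter (i, true) stands for the generator a_i, (i, false) for a_i^-1. *)
Definition letter (N : nat) := ('I_N * bool)%type.

Section FreeGroup.
Variable N : nat.
Implicit Types (a b : letter N) (u v w : seq (letter N)).

Definition linv a : letter N := (a.1, ~~ a.2).

Definition reduced w : bool := sorted (fun a b => b != linv a) w.

Record reduced_word := ReducedWord { word :> seq (letter N); _ : reduced word }.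

HB.instance Definition _ := [isSub for word].
HB.instance Definition _ := [Countable of reduced_word by <:].

Definition fcons a w : seq (letter N) :=
  if w is b :: w' then if b == linv a then w' else a :: w else [:: a].

Definition fmul u v : seq (letter N) := foldr fcons v u.

Definition finv w : seq (letter N) := map linv (rev w).

Lemma linvK : involutive linv.
Proof. by case=> i b; rewrite /linv /= negbK. Qed.

Lemma reduced_behead a w : reduced (a :: w) -> reduced w.
Proof. exact: path_sorted. Qed.

Lemma fcons_reduced a w : reduced w -> reduced (fcons a w).
Proof.
case: w => [//|b w] rw /=; case: ifP => [_|/negbT nab].
  exact: reduced_behead rw.
by rewrite /reduced /= nab.
Qed.

Lemma fmul_reduced u v : reduced v -> reduced (fmul u v).
Proof. by move=> rv; elim: u => [//|a u IH] /=; apply: fcons_reduced. Qed.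

Lemma finv_reduced w : reduced w -> reduced (finv w).
Proof.
rewrite /finv /reduced sorted_map rev_sorted; case: w => [//|a w] /=.
apply: sub_path => x y /= nyx; apply: contra nyx => /eqP /(can_inj linvK) ->.
by rewrite linvK.
Qed.

Lemma fconsK a w : reduced w -> fcons (linv a) (fcons a w) = w.
Proof.
case: w => [_|b w rw] /=; first by rewrite linvK eqxx.
case: eqP => [eb|_]; last by rewrite /= linvK eqxx.
move: rw; rewrite eb; case: w => [//|c w] /= /andP[nc _].
by rewrite (negPf nc).
Qed.

Lemma fmul_fcons a u v : reduced v -> fmul (fcons a u) v = fcons a (fmul u v).
Proof.
move=> rv; case: u => [//|b u] /=; case: eqP => [->|//].
by rewrite -{1}[a]linvK fconsK // fmul_reduced.
Qed.

Lemma fmulA u v w : reduced w -> fmul u (fmul v w) = fmul (fmul u v) w.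
Proof.
by move=> rw; elim: u => [//|a u IH] /=; rewrite fmul_fcons // IH.
Qed.

Lemma fmulw0 w : reduced w -> fmul w [::] = w.
Proof.
elim: w => [//|a w IH] rw /=; rewrite IH ?(reduced_behead rw) //.
by case: w rw {IH} => [//|b w] /= /andP[/negPf ->].
Qed.

Lemma fmulVw w : reduced w -> fmul (finv w) w = [::].
Proof.
elim: w => [//|a w IH] rw.
rewrite /finv rev_cons map_rcons /fmul foldr_rcons /= linvK eqxx.
exact: IH (reduced_behead rw).
Qed.

Lemma finvK : involutive finv.
Proof.
by move=> w; rewrite /finv -map_rev revK -map_comp map_id_in // => a _ /=;
  rewrite linvK.
Qed.

Definition fg_one : reduced_word := @ReducedWord [::] isT.
Definition fg_mul (g h : reduced_word) : reduced_word :=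
  ReducedWord (fmul_reduced g (valP h)).
Definition fg_inv (g : reduced_word) : reduced_word :=
  ReducedWord (finv_reduced (valP g)).

Lemma fg_mulA : associative fg_mul.
Proof. by move=> g h k; apply: val_inj; rewrite /= fmulA ?(valP k). Qed.
Lemma fg_mul1 : left_id fg_one fg_mul.
Proof. by move=> g; apply: val_inj. Qed.
Lemma fg_mulg1 : right_id fg_one fg_mul.
Proof. by move=> g; apply: val_inj; rewrite /= fmulw0 ?(valP g). Qed.
Lemma fg_mulV : left_inverse fg_one fg_inv fg_mul.
Proof. by move=> g; apply: val_inj; rewrite /= fmulVw ?(valP g). Qed.
Lemma fg_invK : involutive fg_inv.
Proof. by move=> g; apply: val_inj; rewrite /= finvK. Qed.
Lemma fg_mulgV : right_inverse fg_one fg_inv fg_mul.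
Proof. by move=> g; rewrite -{1}[g]fg_invK fg_mulV. Qed.

HB.instance Definition _ :=
  isGroup.Build reduced_word fg_mulA fg_mul1 fg_mulg1 fg_mulV fg_mulgV.

End FreeGroup.

Definition free_group (N : nat) : groupType := reduced_word N.

Section L2.
Variables (R : realType) (I : choiceType).
Local Notation C := (R[i]).
Local Notation normc := (@ComplexField.Normc.normc R).

Definition square_summable : {pred I -> C^o} := fun f =>
  `[< \esum_(i in setT) ((normc (f i) ^+ 2)%:E) < +oo >]%E.

Lemma normc_ge0 (z : C) : 0 <= normc z.
Proof. by case: z => a b; rewrite sqrtr_ge0. Qed.

Lemma square_summable_submod : submod_closed square_summable.
Proof.
split=> [|c f g /asboolP ff /asboolP fg].
  apply/asboolP; rewrite esum1 ?ltry // => i _.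
  by rewrite ComplexField.Normc.normc0 expr0n.
apply/asboolP.
pose F (d : R) (h : I -> C) (i : I) := ((d * normc (h i) ^+ 2)%:E).
have F0 d h i : (0 <= d)%R -> (0 <= F d h i)%E.
  by move=> d0; rewrite lee_fin mulr_ge0 // sqr_ge0.
pose k := normc c ^+ 2 *+ 2.
have k0 : 0 <= k by rewrite mulrn_wge0 // sqr_ge0.
have finZ (d : R) (h : I -> C) : (0 <= d)%R ->
    (\esum_(i in setT) ((normc (h i) ^+ 2)%:E) < +oo)%E ->
    (\esum_(i in setT) F d h i < +oo)%E.
  move=> d0 hh; apply: (@le_lt_trans _ _
    (d%:E * \esum_(i in setT) ((normc (h i) ^+ 2)%:E))%E); last first.
    by rewrite lte_mul_pinfty.
  apply: ge_ereal_sup => _ [A [finA _] <-].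
  rewrite /F (eq_fsbigr (fun i => d%:E * (normc (h i) ^+ 2)%:E)%E) => [|//].
  rewrite -ge0_mule_fsumr; last by move=> i; rewrite lee_fin sqr_ge0.
  apply: lee_wpmul2l; first by rewrite lee_fin.
  by apply: esum_ge; exists A.
apply: (@le_lt_trans _ _ (\esum_(i in setT) (F k f i + F (2 : R)%R g i)%E)).
  apply: le_esum => i _; rewrite /F -EFinD lee_fin.
  have -> : (c *: f + g) i = c * f i + g i by [].
  apply: (@le_trans _ _ ((normc (c * f i) + normc (g i)) ^+ 2)).
    by rewrite lerXn2r ?nnegrE ?addr_ge0 ?normc_ge0 // le_normcD.
  rewrite ComplexField.Normc.normcM /k.
  set a := _ * normc (f i); set b := normc (g i).
  have -> : normc c ^+ 2 *+ 2 * normc (f i) ^+ 2 = a ^+ 2 *+ 2.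
    by rewrite /a exprMn mulrnAl.
  rewrite -subr_ge0.
  have -> : a ^+ 2 *+ 2 + 2 * b ^+ 2 - (a + b) ^+ 2 = (a - b) ^+ 2 by ring.
  by rewrite sqr_ge0.
rewrite esumD; [|by move=> *; exact: F0|by move=> *; exact: F0].
by rewrite lte_add_pinfty // finZ.
Qed.

HB.instance Definition _ :=
  GRing.isSubmodClosed.Build C (I -> C^o) square_summable square_summable_submod.

Record l2 := L2 { l2_fun :> I -> C^o; _ : l2_fun \in square_summable }.

HB.instance Definition _ := [isSub for l2_fun].
HB.instance Definition _ := [Choice of l2 by <:].
HB.instance Definition _ := [SubChoice_isSubLmodule of l2 by <:].


(* Only meant for functions f that are absolutely summable. *)
Definition csum (f : I -> C) : C :=
  let rsum (h : I -> R) : R :=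
    fine (\esum_(i in setT) (h^\+ i)%:E) - fine (\esum_(i in setT) (h^\- i)%:E) in
  rsum (fun i => complex.Re (f i)) +i* rsum (fun i => complex.Im (f i)).

Definition dotp (xi eta : l2) : C := csum (fun i => xi i * (eta i)^*).

Definition l2norm (xi : l2) : R :=
  Num.sqrt (fine (\esum_(i in setT) ((normc (xi i) ^+ 2)%:E))).

Lemma delta_square_summable (i : I) :
  (fun j => (j == i)%:R : C^o) \in square_summable.
Proof.
apply/asboolP; rewrite (esumID [set i]) => [|j _]; last first.
  by rewrite lee_fin sqr_ge0.
rewrite setTI esum_set1 ?lee_fin ?sqr_ge0 // esum1 ?adde0 ?ltry // => j [_ /=].
by move=> /eqP/negPf ->; rewrite ComplexField.Normc.normc0 expr0n.
Qed.

Definition delta (i : I) : l2 := L2 (delta_square_summable i).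

Definition bounded_linear (T : {linear l2 -> l2}) : Prop :=
  exists M : R, forall xi : l2, l2norm (T xi) <= M * l2norm xi.

Record bounded_op := BoundedOp
  { op :> {linear l2 -> l2}; op_bounded : bounded_linear op }.

HB.instance Definition _ := gen_eqMixin bounded_op.
HB.instance Definition _ := gen_choiceMixin bounded_op.

Definition is_adjoint (T S : bounded_op) : Prop :=
  forall xi eta : l2, dotp (T xi) eta = dotp xi (S eta).

Definition unitary (T : bounded_op) : Prop :=
  exists S : bounded_op,
    [/\ is_adjoint T S, forall xi, S (T xi) = xi & forall xi, T (S xi) = xi].

(* The weak operator topology on B(l^2): the coarsest topology making every
   T |-> <T xi, eta> continuous. *)
Definition matrix_coefs (T : bounded_op) : {ptws (l2 * l2) -> C^o} :=
  fun p => dotp (T p.1) p.2.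

Definition WOT : Type := initial_topology matrix_coefs.

End L2.

Arguments delta R {I} i.

Section GroupVonNeumannAlgebra.
Variables (R : realType) (G : groupType).
Local Notation C := (R[i]).
Local Notation l2G := (l2 R G).
Implicit Types (g h : G) (xi : l2G) (T : bounded_op R G).

Lemma esum_translate g (a : G -> \bar R) :
  \esum_(h in setT) a (g^-1 * h)%g = \esum_(h in setT) a h.
Proof.
rewrite [RHS](@reindex_esum R _ _ setT setT (fun h => g^-1 * h)%g a) //.
split => [h _ //|h k _ _ /mulgI //|h _].
by exists (g * h)%g => //; rewrite mulKg.
Qed.

Lemma left_reg_square_summable g xi :
  (fun h => xi (g^-1 * h)%g) \in @square_summable R G.
Proof.
apply/asboolP.
rewrite (esum_translate g (fun h => ((ComplexField.Normc.normc (xi h)) ^+ 2)%:E)).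
exact/asboolP/(valP xi).
Qed.

Definition left_reg_fun g xi : l2G := L2 (left_reg_square_summable g xi).

Lemma left_reg_linear g : linear (left_reg_fun g).
Proof. by move=> c xi eta; apply: val_inj. Qed.

HB.instance Definition _ g :=
  GRing.isLinear.Build C l2G l2G *:%R (left_reg_fun g) (left_reg_linear g).

Lemma left_reg_bounded g : bounded_linear (left_reg_fun g).
Proof.
exists 1 => xi; rewrite mul1r /l2norm.
by rewrite (esum_translate g
  (fun h => ((ComplexField.Normc.normc (xi h)) ^+ 2)%:E)).
Qed.

Definition left_reg g : bounded_op R G := BoundedOp (left_reg_bounded g).

Definition left_reg_span : set (bounded_op R G) :=
  [set T | exists s : seq (C * G),
     forall xi, T xi = \sum_(p <- s) p.1 *: left_reg p.2 xi].

Definition group_vN_algebra : set (bounded_op R G) :=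
  closure (left_reg_span : set (WOT R G)).

(* The expansion T = \sum_g t_g u_g of T in the group von Neumann algebra is
   the one determined by T delta_e = \sum_g t_g delta_g in l^2(G). *)
Definition coef T g : C := T (delta R 1%g) g.

Definition Supp T : set G := [set g | coef T g != 0].

Lemma coef_lin_comb T (s : seq G) (t : G -> C) : uniq s ->
    (forall xi, T xi = \sum_(g <- s) t g *: left_reg g xi) ->
  forall g, coef T g = if g \in s then t g else 0.
Proof.
move=> us Ts g; rewrite /coef Ts.
have -> : \sum_(h <- s) t h *: left_reg h (delta R 1%g) =
    (fun k => \sum_(h <- s) t h * (k == h)%:R) :> (G -> C).
  rewrite -[LHS]/(val _) raddf_sum fct_sumE; apply/funext => k.
  apply: eq_bigr => h _; congr (_ * (nat_of_bool _)%:R).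
  by rewrite -[RHS](inj_eq (mulgI h^-1%g)) mulVg.
case: ifP => [gs|/negbT gs].
  rewrite (bigD1_seq g) //= eqxx mulr1 big1 ?addr0 // => h.
  by rewrite eq_sym => /negPf ->; rewrite mulr0.
rewrite big_seq big1 // => h hs; case: eqP => [gh|]; last by rewrite mulr0.
by rewrite gh hs in gs.
Qed.

End GroupVonNeumannAlgebra.

(* Main.v *)
(* In a free group, [|hw| <= |w|] and [|h^-1 w| <= |w|] force [h = 1]: cancelling at
   least half of [h] and half of [h^-1] against [w] makes [h] and [h^-1] share their
   first half.  Hence, for a finite set [A], a pair [(a, b)] in [A^2] maximizing
   [|a^-1 b|] is the only pair of [A^2] with quotient [a^-1 b].  For [A = Supp T]
   with at least two elements, [<T delta_e, T delta_(a^-1 b)>] then has the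
   single nonzero term [t_b * conj t_a], so that [T] is not an isometry.
   Membership in [L(F_N)] is used through [(T xi)(k) = sum_g t_g xi(g^-1 k)]:
   with [eta g = conj (xi (g^-1 k))], this says [<T xi, delta_k> =
   <T delta_e, eta>], which holds for finite combinations of the [u_g] and is
   preserved by weak operator limits. *)
Require Import Defs.
From mathcomp Require Import all_boot all_order all_algebra.
From mathcomp Require Import complex zify.
From mathcomp Require Import all_classical all_reals all_analysis.
Local Open Scope classical_set_scope.
Local Open Scope complex_scope.
Local Open Scope ring_scope.

Import Order.TTheory GRing.Theory Num.Theory.
Import numFieldNormedType.Exports.

Section Auxiliary.
Set Implicit Arguments.
Unset Strict Implicit.

(** * Cancellation in products of reduced words *)

Section FreeGroupWords.
(* [fingraph] also defines [finv]. *)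
Local Notation finv := Defs.finv.
Variable N : nat.
Implicit Types (a b : letter N) (u v w p q r : seq (letter N)).

Lemma linv_neq a : linv a != a.
Proof. by case: a => i [] /=; rewrite /linv /= xpair_eqE eqxx. Qed.

Lemma finv_cat u v : finv (u ++ v) = finv v ++ finv u.
Proof. by rewrite /finv rev_cat map_cat. Qed.

Lemma size_finv u : size (finv u) = size u.
Proof. by rewrite /finv size_map size_rev. Qed.

(** As [u] is reduced, prepending a letter to it can lengthen the cancelled part [q] only when all
    later letters of [u] are already cancelled, i.e. when [p] is empty. *)
Lemma fmul_cancellation u v : reduced u ->
  exists p q r, [/\ u = p ++ finv q, v = q ++ r & fmul u v = p ++ r].
Proof.
elim: u => [|a u IH] ru; first by exists [::], [::], v.
have [p [q [r [eu ev /= ->]]]] := IH (reduced_behead ru).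
case: p => [|b p] in eu *; last first.
  exists (a :: b :: p), q, r; rewrite eu ev; split=> //=.
  by move: ru; rewrite eu /reduced /= => /andP[/negPf ->].
case: r ev => [|c r] ev /=; first by exists [:: a], q, [::]; rewrite eu ev.
case: eqP => [ec|_]; last by exists [:: a], q, (c :: r); rewrite eu ev.
exists [::], (rcons q c), r; rewrite cat_rcons ev eu; split => //=.
by rewrite /finv rev_rcons /= ec linvK.
Qed.

(** The size bound forces [size p <= size q] in the cancellation, so [q], a common prefix of
    [finv u] and [v], covers at least half of [u]. *)
Lemma take_finv_of_fmul_le u v : reduced u ->
  (size (fmul u v) <= size v)%N ->
  take (uphalf (size u)) (finv u) = take (uphalf (size u)) v.
Proof.
move=> /(@fmul_cancellation _ v)[p [q [r [-> -> ->]]]].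
rewrite !size_cat size_finv finv_cat finvK leq_add2r => pq.
have hq : (uphalf (size p + size q) <= size q)%N by lia.
by rewrite !takel_cat.
Qed.

(* If [u] and [finv u] agree on their first halves (rounded up), the middle of
   [u] is a letter equal to its own inverse or a cancelling pair. *)
Lemma reduced_half_palindrome u : reduced u ->
  take (uphalf (size u)) (finv u) = take (uphalf (size u)) u -> u = [::].
Proof.
case: u => // a u; set w := a :: u => rw et; exfalso.
have w0 : (0 < size w)%N by [].
(* The last index compared: the middle one for odd length, the left of the two middle ones for even
   length. *)
pose j := (uphalf (size w)).-1.
have jlt : (j < uphalf (size w))%N by rewrite /j; lia.
have jw : (j < size w)%N by rewrite /j; lia.
have := congr1 (fun s => nth a s j) et.
rewrite !nth_take // /finv (nth_map a) ?size_rev // nth_rev //.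
case: (boolP (odd (size w))) => ow.
  have -> : (size w - j.+1)%N = j by rewrite /j; lia.
  by move/eqP; rewrite (negPf (linv_neq _)).
have -> : (size w - j.+1)%N = j.+1 by rewrite /j; lia.
have j1 : (j.+1 < size w)%N by rewrite /j; lia.
have := sortedP a rw j j1; set x := nth a w j => + ex.
by rewrite -ex linvK eqxx.
Qed.

End FreeGroupWords.

(** * Unique quotients in finite subsets of a free group *)

Lemma free_group_diffuse (N : nat) (h w : free_group N) :
  (size (word (h * w)%g) <= size (word w))%N ->
  (size (word (h^-1 * w)%g) <= size (word w))%N -> h = 1%g.
Proof.
have rh : reduced (word h) by exact: valP h.
move=> /(take_finv_of_fmul_le rh) e1.
move=> /(take_finv_of_fmul_le (finv_reduced rh)).
rewrite size_finv finvK -e1 => e2.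
by apply: val_inj; exact: reduced_half_palindrome.
Qed.

Lemma free_group_unique_quotient (N : nat) (A : set (free_group N)) :
  finite_set A -> A !=set0 ->
  exists a b, [/\ A a, A b,
    forall c d, A c -> A d -> (c^-1 * d = a^-1 * b)%g -> c = a /\ d = b &
    (a = b -> A = [set a])].
Proof.
move=> /finite_seqP[s ->] [x0 x0s].
pose l (p : free_group N * free_group N) := size (word (p.1^-1 * p.2)%g).
have [[a b] /allpairsP[[a' b'] /= [as_ bs [? ?]]] lmax] :
    exists2 p, p \in [seq (c, d) | c <- s, d <- s] &
    forall q, q \in [seq (c, d) | c <- s, d <- s] -> (l q <= l p)%N.
  have : (x0, x0) \in [seq (c, d) | c <- s, d <- s] by apply: allpairs_f.
  move: [seq _ | _ <- _, _ <- _] => t t0.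
  case: (@arg_maxnP _ (SeqSub t0) xpredT (fun p => l (val p))) => // p _ pmax.
  exists (val p); first exact: valP.
  by move=> q qt; exact: (pmax (SeqSub qt)).
subst a' b'.
have {}lmax c d : c \in s -> d \in s ->
    (size (word (c^-1 * d)%g) <= size (word (a^-1 * b)%g))%N.
  by move=> cs ds; apply: (lmax (c, d)); apply: allpairs_f.
exists a, b; split=> //.
  move=> c d cs ds e.
  (* With [w = a^-1 b = c^-1 d] and [h = a^-1 c], the products [h w = a^-1 d] and [h^-1 w = c^-1 b]
     are again quotients from [s], hence no longer than [w]. *)
  have h1 : (a^-1 * c = 1)%g.
    apply: (@free_group_diffuse _ _ (a^-1 * b)%g).
      by rewrite -[in leqLHS]e !mulgA mulgK; apply: lmax.
    by rewrite invgM invgK !mulgA mulgK; apply: lmax.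
  have ca : c = a by rewrite -[c](mulVKg a) h1 mulg1.
  by split=> //; move: e; rewrite ca => /mulgI.
(* Here the maximal length is 0, so every [a^-1 c] is the empty word. *)
move=> ab; rewrite -ab in lmax *; apply/seteqP; split=> [c /= cs|_ ->//].
have := lmax _ _ as_ cs; rewrite mulVg leqn0 => /eqP/size0nil e.
have : (a^-1 * c = 1)%g by apply: val_inj.
by move=> h1; rewrite -[c](mulVKg a) h1 mulg1.
Qed.

(** * Reduction of [csum] to finite sums *)

Section Csum.
Variables (R : realType) (I : choiceType).

Lemma esum_finite_support (s : seq I) (h : I -> R) : uniq s ->
    (forall i, 0 <= h i) -> (forall i, i \notin s -> h i = 0) ->
  \esum_(i in setT) (h i)%:E = (\sum_(i <- s) h i)%:E.
Proof.
move=> us h0 hs.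
transitivity (\esum_(i in [set` s]) (h i)%:E).
  rewrite [RHS]esum_mkcond; apply: eq_esum => i _.
  by case: ifP => // /negbT; rewrite mem_setE => /hs ->.
rewrite esum_fset; last by move=> i _; rewrite lee_fin.
  by rewrite -fsbig_seq // sumEFin.
by apply/finite_seqP; exists s.
Qed.

Lemma csum_finite_support (s : seq I) (f : I -> R[i]) : uniq s ->
    (forall i, i \notin s -> f i = 0) -> csum f = \sum_(i <- s) f i.
Proof.
move=> us fs.
have rsum (h : I -> R) : (forall i, i \notin s -> h i = 0) ->
    fine (\esum_(i in setT) (h^\+ i)%:E) - fine (\esum_(i in setT) (h^\- i)%:E)
    = \sum_(i <- s) h i.
  move=> hs; rewrite !(@esum_finite_support s) //=.
  - rewrite -sumrB; apply: eq_bigr => i _.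
    by rewrite -[in RHS](funrposBneg h).
  - by move=> i /hs hi; rewrite /funrneg hi oppr0 maxxx.
  - by move=> i /hs hi; rewrite /funrpos hi maxxx.
apply/eqP; rewrite eq_complex /csum /= !rsum ?raddf_sum ?eqxx //=.
- by move=> i /fs ->.
- by move=> i /fs ->.
Qed.

Lemma csum_single (i : I) (f : I -> R[i]) :
  (forall j, j != i -> f j = 0) -> csum f = f i.
Proof.
move=> fi; rewrite (@csum_finite_support [:: i]) ?big_seq1 // => j.
by rewrite inE; exact: fi.
Qed.

Lemma dotp_delta (xi : l2 R I) (i : I) : dotp xi (delta R i) = xi i.
Proof.
rewrite /dotp (@csum_single i) => [|j /negPf /= ji].
  by rewrite /= eqxx conjC_nat mulr1.
by rewrite ji conjC_nat mulr0.
Qed.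

End Csum.

(** * The convolution formula on the group von Neumann algebra *)

Section GroupAlgebra.
Variables (R : realType) (G : groupType).
Implicit Types (T : bounded_op R G) (g h k : G) (xi eta : l2 R G).
Local Notation normc := (@ComplexField.Normc.normc R).

Lemma csum_translate g (f : G -> R[i]) :
  csum (fun h => f (g * h)%g) = csum f.
Proof.
have E (a : G -> \bar R) : \esum_(h in setT) a (g * h)%g = \esum_(h in setT) a h.
  by rewrite -[in LHS](invgK g) esum_translate.
by congr (_ +i* _); congr (fine _ - fine _); rewrite -[RHS]E.
Qed.

Lemma normc_conj (z : R[i]) : normc z^* = normc z.
Proof. by case: z => a b /=; rewrite sqrrN. Qed.

Lemma reflect_square_summable k xi :
  (fun g => (xi (g^-1 * k)%g)^* : R[i]^o) \in @square_summable R G.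
Proof.
apply/asboolP; under eq_esum do rewrite normc_conj.
rewrite -(@reindex_esum R _ _ setT setT (fun g => g^-1 * k)%g
  (fun h => (normc (xi h) ^+ 2)%:E)); first exact/asboolP/(valP xi).
split=> [//|g h _ _ /mulIg /invg_inj //|h _].
by exists (k * h^-1)%g => //; rewrite invgM invgK mulgVK.
Qed.

Definition reflect_l2 k xi : l2 R G := L2 (reflect_square_summable k xi).

Lemma dotp_reflect T xi k :
  dotp (T (delta R 1%g)) (reflect_l2 k xi) =
  csum (fun g => coef T g * xi (g^-1 * k)%g).
Proof. by rewrite /dotp; congr csum; apply/funext => g /=; rewrite conjCK. Qed.

Lemma left_reg_span_convolution T xi k : left_reg_span T ->
  T xi k = dotp (T (delta R 1%g)) (reflect_l2 k xi).
Proof.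
case=> s Ts; rewrite dotp_reflect.
have eT eta h : T eta h = \sum_(p <- s) p.1 * eta (p.2^-1 * h)%g.
  by rewrite Ts -[X in X h]/(val _) raddf_sum fct_sumE; apply: eq_bigr.
(* [s] may repeat a group element, so all of its pairs over [g] contribute. *)
have cT g : coef T g = \sum_(p <- s) p.1 * (p.2 == g)%:R.
  rewrite /coef eT; apply: eq_bigr => p _.
  congr (_ * (nat_of_bool _)%:R).
  by rewrite -[LHS](inj_eq (mulgI p.2)) mulVKg mulg1 eq_sym.
rewrite eT (@csum_finite_support _ _ (undup (map snd s))) ?undup_uniq //.
  under [RHS]eq_bigr do rewrite cT mulr_suml.
  rewrite exchange_big /= big_seq [RHS]big_seq; apply: eq_bigr => p ps.
  rewrite (bigD1_seq p.2) ?undup_uniq //=; last by rewrite mem_undup map_f.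
  rewrite eqxx mulr1 big1 ?addr0 // => g /negPf gp.
  by rewrite eq_sym gp mulr0 mul0r.
move=> g; rewrite mem_undup cT => gs; rewrite big_seq big1 ?mul0r // => p ps.
by case: eqP => [pg|]; [rewrite -pg map_f in gs | rewrite mulr0].
Qed.

(** The weak operator topology is initial for [matrix_coefs], and evaluation at [(xi, eta)] is a
    coordinate projection. *)
Lemma continuous_matrix_coef xi eta :
  continuous (fun T : WOT R G => dotp ((T : bounded_op R G) xi) eta : R[i]^o).
Proof.
move=> T; apply: (@continuous_comp (WOT R G)
  {ptws (l2 R G * l2 R G) -> R[i]^o} (R[i]^o) (@matrix_coefs R G)
  (fun c => c (xi, eta))); first exact: initial_continuous.
exact: (@proj_continuous _ (fun=> R[i]^o) (xi, eta)).
Qed.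

Lemma group_vN_algebra_convolution T xi k : group_vN_algebra T ->
  T xi k = csum (fun g => coef T g * xi (g^-1 * k)%g).
Proof.
rewrite -dotp_reflect -[LHS]dotp_delta.
(* A difference of two matrix coefficients: its zero set is closed and contains the span, hence also
   the closure. *)
pose f (S : WOT R G) : R[i]^o := dotp ((S : bounded_op R G) xi) (delta R k)
  - dotp ((S : bounded_op R G) (delta R 1%g)) (reflect_l2 k xi).
have cf : continuous f.
  move=> S; exact: (cvgB (@continuous_matrix_coef xi (delta R k) S)
    (@continuous_matrix_coef (delta R 1%g) (reflect_l2 k xi) S)).
have f0 : closed (f @^-1` [set 0]).
  move: cf => /continuous_closedP; apply.
  exact/accessible_closed_set1/hausdorff_accessible/norm_hausdorff.
rewrite /group_vN_algebra => /(@closureS _ _ (f @^-1` [set 0])).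
move=> cl; apply/eqP; rewrite -subr_eq0; apply/eqP.
suff /cl : (@left_reg_span R G : set (WOT R G)) `<=` f @^-1` [set 0].
  by rewrite -((closure_id _).1 f0).
move=> S spS; rewrite /f /= dotp_delta.
by rewrite (left_reg_span_convolution _ _ spS) subrr.
Qed.

End GroupAlgebra.

(** * Coefficients of unitaries *)

Section Unitary.
Variables (R : realType) (G : groupType).
Implicit Types (T : bounded_op R G) (g h k : G) (xi eta : l2 R G).
Local Notation normc := (@ComplexField.Normc.normc R).

(** Both sides are [<T delta_e, T delta_h>]: the convolution formula gives
    [(T delta_h)(k) = coef T (k h^-1)], and the adjoint turns the product into
    [<delta_e, delta_h>]. *)
Lemma unitary_coef T h : group_vN_algebra T -> unitary T ->
  csum (fun k => coef T k * (coef T (k * h^-1)%g)^*) = (h == 1%g)%:R.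
Proof.
move=> vT [S [adj ST _]].
have <- : dotp (T (delta R 1%g)) (T (delta R h)) = (h == 1%g)%:R.
  rewrite adj ST dotp_delta /=; congr (nat_of_bool _)%:R.
congr csum; apply/funext => k; congr (_ * _^*).
rewrite (group_vN_algebra_convolution _ _ vT) (@csum_single _ _ (k * h^-1)%g).
  by rewrite /= invgM invgK mulgVK eqxx mulr1.
move=> g /= gk; case: eqP => [e|_]; last by rewrite mulr0.
by rewrite -e invgM invgK mulVKg eqxx in gk.
Qed.

Lemma scaled_left_reg_bounded (c : R[i]) g : normc c = 1 ->
  bounded_linear (c \*: left_reg_fun (R := R) g).
Proof.
move=> c1; have [M bM] := @left_reg_bounded R G g.
exists M => xi; apply: le_trans (bM xi); rewrite /l2norm.
rewrite (_ : \esum_(i in _) _ =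
  \esum_(i in [set: G]) (normc (left_reg_fun g xi i) ^+ 2)%:E) //.
apply: eq_esum => k _; congr (_ ^+ 2)%:E.
by rewrite -[RHS]mul1r -c1 -ComplexField.Normc.normcM.
Qed.

(** The convolution formula collapses to [T = t u_a] with [t] of modulus 1, whose adjoint and
    inverse is [t^* u_(a^-1)]. *)
Lemma unitary_of_singleton_support T a : group_vN_algebra T ->
  Supp T = [set a] -> (coef T a)^* * coef T a = 1 -> unitary T.
Proof.
move=> vT ST; set t := coef T a => t1.
have eT xi k : T xi k = t * xi (a^-1 * k)%g.
  rewrite (group_vN_algebra_convolution _ _ vT) (@csum_single _ _ a) // => g.
  move=> ga; suff -> : coef T g = 0 by rewrite mul0r.
  apply/eqP; apply: contraNT ga => Sg; apply/eqP.
  by have : Supp T g; last rewrite ST.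
have nt : normc t^* = 1.
  rewrite normc_conj; apply/eqP; rewrite -(@pexpr_eq1 _ _ 2) ?normc_ge0 //.
  rewrite expr2 -[X in X * _]normc_conj -ComplexField.Normc.normcM t1.
  by rewrite /= expr1n expr0n addr0 sqrtr1.
exists (BoundedOp (scaled_left_reg_bounded a^-1 nt)); split.
- move=> xi eta; rewrite /dotp -[LHS](csum_translate a); congr csum.
  apply/funext => k; rewrite eT mulKg /= invgK.
  by rewrite rmorphM /= conjCK mulrCA mulrA.
- move=> xi; apply: val_inj; apply/funext => k /=.
  by rewrite -[LHS]/(t^* * T xi (a^-1^-1 * k)%g) eT invgK mulKg mulrA t1 mul1r.
- move=> xi; apply: val_inj; apply/funext => k /=.
  rewrite eT -[X in t * X]/(t^* * xi (a^-1^-1 * (a^-1 * k))%g).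
  by rewrite invgK mulVKg mulrA [t * _]mulrC t1 mul1r.
Qed.

End Unitary.
End Auxiliary.

Theorem proposition5p3 (R : realType) (N : nat)
    (T : bounded_op R (free_group N)) :
  group_vN_algebra T -> finite_set (Supp T) ->
  (unitary T <->
   [set (g1^-1 * g2)%g | g1 in Supp T & g2 in Supp T] = [set 1%g] /\
   \sum_(p \in Supp T `*` Supp T) (coef T p.1)^* * coef T p.2 = 1).
Proof.
have setX1 (a : free_group N) : [set a] `*` [set a] = [set (a, a)].
  by apply/seteqP; split=> [[x y] [/= -> ->]|_ ->].
move=> vT finT; split=> [uT|[e1 s1]].
(* Empty support would make [<T delta_e, T delta_e>] equal to 0 instead of 1. *)
- have Sne : Supp T !=set0.
    apply/set0P/negP => /eqP S0.
    have := unitary_coef 1%g vT uT; rewrite eqxx (@csum_single _ _ 1%g).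
      suff -> : coef T 1%g = 0 by rewrite mul0r => /esym/eqP; rewrite oner_eq0.
      by apply/eqP/negPn/negP => S1; have : Supp T 1%g by []; rewrite S0.
    move=> j _; suff -> : coef T j = 0 by rewrite mul0r.
    by apply/eqP/negPn/negP => Sj; have : Supp T j by []; rewrite S0.
  have [a [b [Sa Sb uniq_ab Sab]]] := free_group_unique_quotient finT Sne.
  have := unitary_coef (a^-1 * b)%g vT uT.
  (* A nonzero term at [k] puts [k h^-1] and [k] in the support, where [h = a^-1 b]; their quotient
     is [h], so uniqueness gives [k = b]. *)
  rewrite (@csum_single _ _ b) => [|k kb]; last first.
    apply/eqP; apply: contraNT kb; rewrite mulf_eq0 negb_or conjC_eq0.
    move=> /andP[Sk Skh]; apply/eqP.
    have [|//] := uniq_ab (k * (a^-1 * b)^-1)%g k Skh Sk.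
    by rewrite invgM invgK mulgVK.
  rewrite invgM invgK mulVKg => tab.
  (* The surviving term is nonzero, so the indicator of [a^-1 b = 1] cannot vanish. *)
  have ab : a = b.
    have : coef T b * (coef T a)^* != 0 by rewrite mulf_neq0 ?conjC_eq0.
    rewrite tab; case: (_ =P 1%g) => [h1 _|_]; last by rewrite eqxx.
    by rewrite -[b](mulVKg a) h1 mulg1.
  move: tab; rewrite -ab mulVg eqxx => taa; rewrite (Sab ab); split.
    apply/seteqP; split=> [_ [_ -> [_ -> <-]]|_ ->]; first by rewrite mulVg.
    by exists a => //; exists a => //; rewrite mulVg.
  by rewrite setX1 fsbig_set1 mulrC.
(* Conversely, 1 being a quotient gives a point [a] of the support, and the absence of other
   quotients makes it the only one. *)
have [a Sa] : Supp T !=set0.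
  have : [set 1%g] (1%g : free_group N) by [].
  by rewrite -e1 => -[a Sa _]; exists a.
have ST : Supp T = [set a].
  apply/seteqP; split=> [b Sb|_ ->//].
  have : [set (g1^-1 * g2)%g | g1 in Supp T & g2 in Supp T] (a^-1 * b)%g.
    by exists a => //; exists b.
  by rewrite e1 /= => h1; rewrite -[b](mulVKg a) h1 mulg1.
apply: (unitary_of_singleton_support vT ST); move: s1.
by rewrite ST setX1 fsbig_set1.
Qed.
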